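(* There exists a compact metric space that admits a convex bicombing which is not consistent.
   Context: Let $(X,d)$ be a metric space. A (geodesic) bicombing on $X$ is a map $\sigma\colon X\times X\times[0,1]\to X$ such that, writing $\sigma_{pq}(t):=\sigma(p,q,t)$, for all $p,q\in X$ one has $\sigma_{pq}(0)=p$, $\sigma_{pq}(1)=q$, and $d(\sigma_{pq}(t),\sigma_{pq}(s))=|t-s|\cdot d(p,q)$ for all $s,t\in[0,1]$. The bicombing $\sigma$ is convex if for all $p,q,p',q'\in X$ the function $t\mapsto d(\sigma_{pq}(t),\sigma_{p'q'}(t))$ is convex on $[0,1]$. It is consistent if for all $p,q\in X$ we have $\sigma_{p'q'}([0,1])\subset\sigma_{pq}([0,1])$ whenever $p'=\sigma_{pq}(s)$ and $q'=\sigma_{pq}(t)$ with $0\le s\le t\le 1$. *)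

(* Defs.v *)
From HB Require Import structures.
From mathcomp Require Import all_boot all_order all_algebra.
From mathcomp Require Import all_classical all_reals all_analysis.

Set Implicit Arguments.
Unset Strict Implicit.
Unset Printing Implicit Defensive.

Import Order.TTheory GRing.Theory Num.Theory.
Import numFieldNormedType.Exports.

Local Open Scope classical_set_scope.
Local Open Scope ring_scope.

Section Bicombing.
Context {R : realType} {X : metricType R}.

(* A map X * X * [0, 1] -> X is encoded as a function X -> X -> R -> X of which
   only the values at parameters in [0, 1] matter: each predicate below looks at
   [sigma p q] on [0, 1] alone. *)
Implicit Type sigma : X -> X -> R -> X.

Definition bicombing sigma : Prop :=
  forall p q : X,
    [/\ sigma p q 0 = p,
        sigma p q 1 = q
      & forall s t : R, s \in `[0, 1] -> t \in `[0, 1] ->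
          mdist (sigma p q t) (sigma p q s) = `|t - s| * mdist p q].

Definition convex_bicombing sigma : Prop :=
  bicombing sigma /\
  forall p q p' q' : X,
    convex_function (`[0, 1]%classic : set R^o)
      (fun t : R => mdist (sigma p q t) (sigma p' q' t)).

Definition consistent sigma : Prop :=
  forall (p q : X) (s t : R), 0 <= s -> s <= t -> t <= 1 ->
    sigma (sigma p q s) (sigma p q t) @` `[0, 1] `<=` sigma p q @` `[0, 1].

End Bicombing.

(* Main.v *)
Require Import Defs.
From HB Require Import structures.
From mathcomp Require Import all_boot all_order all_algebra.
From mathcomp Require Import all_classical all_reals all_analysis.
From mathcomp Require Import ring lra.

(** The space is a thin lens [|b| <= 1], [0 <= u <= k (1 - b ^ 2)] in the plane
    of pairs [(b, u)], with two antennas, the segments [1 <= |b| <= 2] of the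
    axis [u = 0], attached at its tips.  The norm is
    [max (|b|, sqrt ((b ^ 2 + u ^ 2) / 2))]; its unit ball is a round disc with
    two opposite caps cut off by the lines [b = 1] and [b = - 1].  Because of
    the flat sides, every curve with affine [b] and with [|du/db| <= 1] is a
    geodesic, so there is much freedom to choose geodesics; the round part
    supplies the strict convexity which makes a small perturbation harmless.

    All paths have an affine abscissa [b].  Two points of the lens are joined by
    the straight segment.  A point of an antenna and a point of the lens are
    joined by the axis up to the tip, then by a segment.  The path from a point
    of the left antenna at distance [x] from the lens to a point of the right
    antenna at distance [y] from it follows the axis outside the lens and the
    arc [u = k x y (1 - b ^ 2)] inside; in the opposite direction it stays on
    the axis.  If [x] and [y] are positive, the path from the same initial point
    to the point of the arc at [b = 0] runs below the arc, so the bicombing is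
    not consistent ([sigma_not_consistent]).

    For convexity it is enough to find, at each interior time, a local
    supporting line of the distance between two paths ([supported_convex]).
    Write [s] for the difference of abscissas, which is affine in time, and [g]
    for the difference of heights.  Where [|g| <= |s|] the distance is [|s|] and
    there is nothing to do.  Where [|g| > |s|] both points lie strictly inside
    the lens, since a point of the lens is seen from an antenna or a tip under a
    small slope ([flat_at_end]).  There [g] is quadratic in time, and it is
    affine unless one of the paths is an arc.  In the remaining case the radius
    of the round part gains [(s' g - s g') ^ 2] in convexity, up to scaling, and
    this has to beat the second derivative of [g] ([ell_support]).  It does:
    let [e] be the sum of the values of [|s|] at the two ends.  An arc and any
    other path differ, in height, slope and curvature, by a small multiple of
    [e] ([coeff_bounds]).  The reason is that the factor [x y] dies out when an
    endpoint of the arc slides down to a tip, and that the lens is thin near its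
    tips.  So [|s| < |g|] makes [s] small against [e] at that time, which forces
    the slope of [s] to be of order [e], and the slack dominates. *)

Set Implicit Arguments.
Unset Strict Implicit.
Unset Printing Implicit Defensive.

Import Order.TTheory GRing.Theory Num.Theory.
Import numFieldNormedType.Exports.

Local Open Scope classical_set_scope.
Local Open Scope ring_scope.

(** * Local supporting lines and convexity *)

Section LocalSupport.
Context {R : realType}.
Implicit Types f : R -> R.

Definition supported_at f (t0 : R) : Prop :=
  exists m e : R, 0 < e /\
    forall t, `|t - t0| < e -> f t0 + m * (t - t0) <= f t.

(** If [f] exceeds its chord somewhere, subtracting the chord and a small bump
    [h (y - t) (t - x)] leaves a function with an interior maximum.  A supporting
    line of [f] there is incompatible with the strictly concave bump. *)
Lemma supported_chord f x y z :
  x < z -> z < y ->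
  {within `[x, y], continuous f} ->
  (forall t, x < t < y -> supported_at f t) ->
  (y - x) * f z <= (y - z) * f x + (z - x) * f y.
Proof.
move=> xz zy cf sf; rewrite leNgt; apply/negP => above.
have yx : 0 < y - x by lra.
pose s := (f y - f x) / (y - x).
have sE : s * (y - x) = f y - f x by rewrite /s divfK// gt_eqF.
have M0 : 0 < f z - f x - s * (z - x).
  rewrite -(pmulr_rgt0 _ yx).
  suff -> : (y - x) * (f z - f x - s * (z - x)) =
    (y - x) * f z - ((y - z) * f x + (z - x) * f y) by rewrite subr_gt0.
  transitivity ((y - x) * (f z - f x) - s * (y - x) * (z - x)); first by ring.
  by rewrite sE; ring.
set M := (X in 0 < X) in M0.
have P0 : 0 < (y - z) * (z - x) by rewrite mulr_gt0 ?subr_gt0.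
pose h := M / 2 / ((y - z) * (z - x)).
have h0 : 0 < h by rewrite !divr_gt0.
have hE : h * ((y - z) * (z - x)) = M / 2 by rewrite /h divfK// gt_eqF.
pose g (t : R) := f t - (s * t + h * ((y - t) * (t - x))).
have cq : continuous (fun t : R => s * t + h * ((y - t) * (t - x))).
  move=> u; apply: cvgD; first by apply: cvgM; [exact: cvg_cst|exact: cvg_id].
  apply: cvgM; first exact: cvg_cst.
  by apply: cvgM; apply: cvgB; (exact: cvg_cst || exact: cvg_id).
have cg : {within `[x, y], continuous g}.
  by move=> t; apply: cvgB; [exact: cf|exact: (continuous_subspaceT cq)].
have [|c cxy gc] := EVT_max _ cg; first by lra.
have gz : g z <= g c by apply: gc; rewrite in_itv/=; apply/andP; split; lra.
have zE : g z = f x - s * x + M / 2 by rewrite /g hE /M; lra.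
have cx : c != x.
  apply/eqP => cE; move: gz; rewrite zE /g cE; nra.
have cy : c != y.
  apply/eqP => cE; move: gz; rewrite zE /g cE; nra.
move: cxy; rewrite in_itv/= => /andP[xc cley].
have xltc : x < c by rewrite lt_neqAle eq_sym cx.
have clty : c < y by rewrite lt_neqAle cy.
have [|m [e [e0 me]]] := sf c; first by rewrite xltc.
pose r := Num.min (e / 2) (Num.min (c - x) (y - c)).
have r0 : 0 < r by rewrite !lt_min; apply/and3P; split; lra.
have re : r <= e / 2 by rewrite ge_min lexx.
have rx : r <= c - x by rewrite !ge_min lexx orbT.
have ry : r <= y - c by rewrite !ge_min lexx !orbT.
(* Comparing at [c + r] and [c - r] makes the unknown slope [m] drop out. *)
have up := me (c + r); have dn := me (c - r).
have gup : g (c + r) <= g c.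
  by apply: gc; rewrite in_itv/=; apply/andP; split; lra.
have gdn : g (c - r) <= g c.
  by apply: gc; rewrite in_itv/=; apply/andP; split; lra.
have {}up : f c + m * r <= f (c + r).
  by have := up; rewrite addrAC subrr add0r; apply; rewrite gtr0_norm//; lra.
have {}dn : f c - m * r <= f (c - r).
  have := dn; rewrite addrAC subrr add0r mulrN; apply.
  by rewrite normrN gtr0_norm//; lra.
have : 0 < h * r ^+ 2 by rewrite mulr_gt0// exprn_gt0.
rewrite /g in gup gdn; nra.
Qed.

Lemma supported_convex f : continuous f ->
  (forall t, 0 < t < 1 -> supported_at f t) ->
  forall x y l : R, 0 <= x <= 1 -> 0 <= y <= 1 -> 0 <= l <= 1 ->
  f (l * x + (1 - l) * y) <= l * f x + (1 - l) * f y.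
Proof.
move=> cf sf x y l x01 y01 l01.
wlog xy : x y l x01 y01 l01 / x < y.
  move=> H; have [xy|yx|<-] := ltgtP x y; first exact: H.
    have l01' : 0 <= 1 - l <= 1.
      by case/andP: l01 => ? ?; rewrite subr_ge0 gerBl; apply/andP.
    have := H y x (1 - l) y01 x01 l01' yx.
    by rewrite subKr [(1 - l) * y + _]addrC [(1 - l) * f y + _]addrC.
  by rewrite -!mulrDl addrC subrK !mul1r.
have [->|l0] := eqVneq l 0; first by rewrite !mul0r !add0r subr0 !mul1r.
have [->|l1] := eqVneq l 1; first by rewrite !mul1r subrr !mul0r !addr0.
case/andP: l01 => l0' l1'.
have {}l0 : 0 < l by rewrite lt_neqAle eq_sym l0.
have {}l1 : l < 1 by rewrite lt_neqAle l1.
have d0 : 0 < y - x by rewrite subr_gt0.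
case/andP: x01 => ? ?; case/andP: y01 => ? ?.
have p1 : 0 < l * (y - x) by rewrite mulr_gt0.
have p2 : 0 < (1 - l) * (y - x) by rewrite mulr_gt0// subr_gt0.
set z := l * x + (1 - l) * y.
have xz : x < z by rewrite /z; move: p2; clear; lra.
have zy : z < y by rewrite /z; move: p1; clear; lra.
rewrite -(ler_pM2l d0).
have -> : (y - x) * (l * f x + (1 - l) * f y) = (y - z) * f x + (z - x) * f y.
  by rewrite /z; ring.
apply: supported_chord => //; first exact: continuous_subspaceT.
by move=> t /andP[? ?]; apply: sf; apply/andP; split; lra.
Qed.

End LocalSupport.

(** * A norm with flat sides and a round part *)

Section Norm.
Context {R : realType}.
Implicit Types a b c d : R.

(** The halving makes the circle [ell = 1] meet the lines [|a| = 1] at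
    [|b| = 1], so that [nrm] is read off from the comparison of [|a|] and [|b|]
    ([nrm_flat], [nrm_steep]). *)
Definition ell a b : R := Num.sqrt ((a ^+ 2 + b ^+ 2) / 2).
Definition nrm a b : R := Num.max `|a| (ell a b).

Lemma half_ge0 a b : 0 <= (a ^+ 2 + b ^+ 2) / 2.
Proof. by rewrite divr_ge0// addr_ge0// sqr_ge0. Qed.

Lemma ell_ge0 a b : 0 <= ell a b. Proof. exact: sqrtr_ge0. Qed.

Lemma sqr_ell a b : ell a b ^+ 2 = (a ^+ 2 + b ^+ 2) / 2.
Proof. by rewrite sqr_sqrtr// half_ge0. Qed.

Lemma sqrt_le (x y : R) : 0 <= y -> x <= y ^+ 2 -> Num.sqrt x <= y.
Proof.
by move=> y0 xy; rewrite -[leRHS]ger0_norm// -sqrtr_sqr; exact: ler_wsqrtr.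
Qed.

Lemma le_sqrt (x y : R) : y ^+ 2 <= x -> y <= Num.sqrt x.
Proof.
move=> yx; rewrite (le_trans (ler_norm _))// -sqrtr_sqr; exact: ler_wsqrtr.
Qed.

Lemma le_of_sqr (x y : R) : 0 <= y -> x ^+ 2 <= y ^+ 2 -> x <= y.
Proof.
move=> y0 xy; rewrite (le_trans (ler_norm _))// -[leRHS]ger0_norm//.
by rewrite -[leLHS]sqrtr_sqr -[leRHS]sqrtr_sqr; exact: ler_wsqrtr.
Qed.

Lemma ell_triangle a b c d : ell (a + c) (b + d) <= ell a b + ell c d.
Proof.
apply: sqrt_le; first by rewrite addr_ge0 ?ell_ge0.
have A := sqr_ell a b; have C := sqr_ell c d.
have cs : (a * c + b * d) / 2 <= ell a b * ell c d.
  apply: le_of_sqr; first by rewrite mulr_ge0 ?ell_ge0.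
  rewrite (exprMn _ (ell a b)) A C.
  have : 0 <= (a * d - b * c) ^+ 2 by exact: sqr_ge0.
  by lra.
have -> : (ell a b + ell c d) ^+ 2 =
  ell a b ^+ 2 + ell c d ^+ 2 + 2 * (ell a b * ell c d) by ring.
by rewrite A C; lra.
Qed.

Lemma nrm_triangle a b c d : nrm (a + c) (b + d) <= nrm a b + nrm c d.
Proof.
rewrite ge_max; apply/andP; split.
  by rewrite (le_trans (ler_normD _ _))// lerD// le_max lexx.
by rewrite (le_trans (ell_triangle _ _ _ _))// lerD// le_max lexx orbT.
Qed.

Lemma nrmN a b : nrm (- a) (- b) = nrm a b.
Proof. by rewrite /nrm /ell normrN !sqrrN. Qed.

Lemma nrm00 : nrm 0 0 = 0.
Proof. by rewrite /nrm /ell normr0 expr0n/= addr0 mul0r sqrtr0 maxxx. Qed.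

Lemma nrm_eq0 a b : nrm a b = 0 -> a = 0 /\ b = 0.
Proof.
move=> n0.
have a0 : `|a| <= 0 by rewrite -n0 le_max lexx.
have e0 : ell a b <= 0 by rewrite -n0 le_max lexx orbT.
have {}a0 : a = 0 by apply/eqP; rewrite -normr_le0.
split => //; apply/eqP; rewrite -sqrf_eq0 eq_le sqr_ge0 andbT.
have {e0} e0 : ell a b = 0 by apply/le_anti; rewrite e0 ell_ge0.
by have := sqr_ell a b; rewrite e0 a0; lra.
Qed.

Lemma nrmZ (l : R) a b : nrm (l * a) (l * b) = `|l| * nrm a b.
Proof.
rewrite /nrm maxr_pMr// normrM; congr Num.max.
by rewrite /ell !exprMn -mulrDr -mulrA sqrtrM ?sqr_ge0// sqrtr_sqr.
Qed.

Lemma nrm_flat a b : `|b| <= `|a| -> nrm a b = `|a|.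
Proof.
move=> ba; apply/max_idPl; apply: sqrt_le => //.
have : `|b| ^+ 2 <= `|a| ^+ 2 by rewrite ler_sqr ?nnegrE.
by rewrite !real_normK ?num_real//; lra.
Qed.

Lemma nrm_steep a b : `|a| <= `|b| -> nrm a b = ell a b.
Proof.
move=> ba; apply/max_idPr; apply: le_sqrt.
have : `|a| ^+ 2 <= `|b| ^+ 2 by rewrite ler_sqr ?nnegrE.
by rewrite !real_normK ?num_real//; lra.
Qed.

Lemma nrm_le a b : nrm a b <= `|a| + `|b|.
Proof.
have ha : `|a| <= `|a| + `|b| by rewrite lerDl.
rewrite ge_max ha/=; apply: sqrt_le; first by rewrite addr_ge0.
have -> : a ^+ 2 = `|a| ^+ 2 by rewrite real_normK ?num_real.
have -> : b ^+ 2 = `|b| ^+ 2 by rewrite real_normK ?num_real.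
have : 0 <= `|a| * `|b| by rewrite mulr_ge0.
have := sqr_ge0 `|a|; have := sqr_ge0 `|b|; nra.
Qed.

(** Along a straight line the Euclidean radius has second derivative
    [(s g1 - b g0) ^ 2 / r ^ 3].  When [g0], [g1], [g2] are small against the
    speed [b] in the flat direction, [b g0] dominates in this expression and
    absorbs the contribution of [g2]. *)
Lemma ell_support (s b g0 g1 g2 : R) :
  `|s| < `|g0| ->
  g2 = 0 \/ [/\ `|g0| <= `|b| / 5, `|g1| <= `|b| / 5 & `|g2| <= `|b| / 5] ->
  exists m : R, forall t : R, `|t| <= 1 ->
    ell s g0 + m * t <= ell (s + b * t) (g0 + g1 * t + g2 * t ^+ 2).
Proof.
move=> sg small.
have g00 : 0 < `|g0| by rewrite (le_lt_trans _ sg).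
have g02 : g0 ^+ 2 = `|g0| ^+ 2 by rewrite real_normK ?num_real.
have sg2 : s ^+ 2 <= g0 ^+ 2.
  rewrite g02 -[s ^+ 2]real_normK ?num_real// ler_sqr ?nnegrE//; exact: ltW.
have E := sqr_ell s g0.
have r2 : 0 < ell s g0 ^+ 2.
  by rewrite E divr_gt0// ltr_wpDl ?sqr_ge0// g02 exprn_gt0.
set r := ell s g0 in E r2 *.
have r0 : r != 0 by rewrite -sqrf_eq0 gt_eqF.
exists ((s * b + g0 * g1) / 2 / r) => t t1; apply: le_sqrt.
set m := _ / r.
have mE : m * r = (s * b + g0 * g1) / 2 by rewrite /m divfK.
(* Lagrange's identity: what the tangent line leaves over. *)
have lag : (b ^+ 2 + g1 ^+ 2) / 2 - m ^+ 2 = (s * g1 - b * g0) ^+ 2 / 4 / r ^+ 2.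
  have r20 : r ^+ 2 != 0 by rewrite gt_eqF.
  apply: (mulIf r20); rewrite divfK// mulrBl -exprMn mE E; by field.
suff : 0 <= t ^+ 2 * ((b ^+ 2 + g1 ^+ 2) / 2 - m ^+ 2 + g0 * g2 + g1 * g2 * t +
    g2 ^+ 2 * t ^+ 2 / 2).
  have -> : (r + m * t) ^+ 2 = r ^+ 2 + 2 * (m * r) * t + m ^+ 2 * t ^+ 2 by ring.
  rewrite mE E; lra.
apply: mulr_ge0; rewrite ?sqr_ge0// lag.
have q0 : 0 <= (s * g1 - b * g0) ^+ 2 / 4 / r ^+ 2.
  by rewrite !divr_ge0// sqr_ge0.
case: small => [->|[G0 G1 G2]]; first by rewrite expr0n/= !mulr0 !mul0r; lra.
have b02 : b ^+ 2 = `|b| ^+ 2 by rewrite real_normK ?num_real.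
have cross : `|b| * `|g0| * (4 / 5) <= `|s * g1 - b * g0|.
  have h1 : `|s * g1| <= `|g0| * (`|b| / 5) by rewrite normrM ler_pM// ltW.
  have h2 := ler_normB (s * g1) (s * g1 - b * g0).
  move: h2; rewrite opprB addrC subrK normrM; lra.
have slack : `|b| ^+ 2 * (4 / 25) <= (s * g1 - b * g0) ^+ 2 / 4 / r ^+ 2.
  rewrite ler_pdivlMr// E -[(s * g1 - _) ^+ 2]real_normK ?num_real//.
  have : (`|b| * `|g0| * (4 / 5)) ^+ 2 <= `|s * g1 - b * g0| ^+ 2.
    by rewrite ler_sqr ?nnegrE ?mulr_ge0.
  have : 0 <= `|b| ^+ 2 * (g0 ^+ 2 - s ^+ 2).
    by rewrite mulr_ge0 ?sqr_ge0// subr_ge0.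
  rewrite g02 => ? ?; lra.
have e1 : `|g0 * g2| <= `|b| / 5 * (`|b| / 5) by rewrite normrM ler_pM.
have e2 : `|g1 * g2 * t| <= `|b| / 5 * (`|b| / 5).
  rewrite -[leRHS]mulr1 normrM ler_pM//.
  by rewrite normrM ler_pM.
have e3 : 0 <= g2 ^+ 2 * t ^+ 2 / 2 by rewrite divr_ge0// mulr_ge0// sqr_ge0.
move: e1 e2; rewrite !ler_norml => /andP[e1 _] /andP[e2 _].
have := sqr_ge0 `|b|; lra.
Qed.

End Norm.

(** * Truncations of the line *)

Section Clamp.
Context {R : realType}.
Implicit Types b c : R.

Definition pos b : R := Num.max 0 b.
Definition clamp b : R := Num.max (-1) (Num.min 1 b).

Lemma posP b : (b <= 0 /\ pos b = 0) \/ (0 <= b /\ pos b = b).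
Proof.
rewrite /pos; case: (leP 0 b) => h; first by right.
by left; split=> //; exact: ltW.
Qed.

Lemma clampP b : [\/ b <= -1 /\ clamp b = -1, (-1 <= b /\ b <= 1) /\ clamp b = b
  | 1 <= b /\ clamp b = 1].
Proof.
rewrite /clamp; case: (leP 1 b) => h.
  by apply: Or33; split => //; apply/max_idPr; lra.
case: (leP (-1) b) => h'; last by apply: Or31; split => //; exact: ltW.
by apply: Or32; split => //; split => //; exact: ltW.
Qed.

Lemma clamp_id b : `|b| <= 1 -> clamp b = b.
Proof. by rewrite ler_norml => /andP[? ?]; case: (clampP b) => -[]; lra. Qed.

Lemma clamp_bound b : -1 <= clamp b /\ clamp b <= 1.
Proof. by case: (clampP b) => -[]; lra. Qed.

Lemma clamp_mono b c : b <= c -> clamp b <= clamp c.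
Proof. by case: (clampP b) => -[] ? ->; case: (clampP c) => -[] ? ->; lra. Qed.

Lemma clamp_lip b c : `|clamp b - clamp c| <= `|b - c|.
Proof.
wlog bc : b c / b <= c.
  by move=> H; case/orP: (le_total b c) => /H//; rewrite distrC [leRHS]distrC.
rewrite distrC [leRHS]distrC !ger0_norm ?subr_ge0 ?clamp_mono//.
by case: (clampP b) => -[] ? ->; case: (clampP c) => -[] ? ->; lra.
Qed.

Lemma pos_lip b c : `|pos b - pos c| <= `|b - c|.
Proof.
wlog bc : b c / b <= c.
  by move=> H; case/orP: (le_total b c) => /H//; rewrite distrC [leRHS]distrC.
rewrite distrC [leRHS]distrC [leRHS]ger0_norm ?subr_ge0//.
rewrite ler_norml; apply/andP.
by case: (posP b) => -[] ? ->; case: (posP c) => -[] ? ->; lra.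
Qed.

Lemma pos_ge0 b : 0 <= pos b. Proof. by rewrite le_max lexx. Qed.

End Clamp.

(** * The lens with antennas and its paths *)

Section Lens.
Context {R : realType}.
Implicit Types (p q : R * R) (b t s : R).

(** The half-width constant of the lens; any small enough value would do.  It is
    locked so that unification does not unfold it into a product. *)
Definition thin : R := locked (1 / 1000).
Notation k := thin.

Lemma thinE : k = 1 / 1000. Proof. by rewrite /thin -lock. Qed.
Lemma thin_gt0 : 0 < k. Proof. by rewrite thinE; lra. Qed.

Definition width b : R := k * (1 - clamp b ^+ 2).

(** Since [width] vanishes for [1 <= |b|], this includes the two antennas. *)
Definition lens p : bool := (-2 <= p.1 <= 2) && (0 <= p.2 <= width p.1).

Definition absc p q t : R := p.1 + t * (q.1 - p.1).

(** The weight of [q] in the unperturbed height: affine in [clamp b], hence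
    constant along the antennas.  When the clamped abscissas agree, either both
    points are on one vertical line of the lens, where time is the right weight,
    or both have height 0. *)
Definition share p q t : R :=
  if clamp p.1 == clamp q.1 then t
  else (clamp (absc p q t) - clamp p.1) / (clamp q.1 - clamp p.1).

(** The height of the perturbing arc at [b = 0]; nonzero only from the left antenna to the
    right one, and tending to 0 as an endpoint approaches a tip. *)
Definition bulge p q : R := k * (pos (-1 - p.1) * pos (q.1 - 1)).

Definition height p q t : R :=
  p.2 + share p q t * (q.2 - p.2) + bulge p q * (1 - clamp (absc p q t) ^+ 2).

Definition trace p q t : R * R := (absc p q t, height p q t).

(** How far the pair is from going from the left antenna to the right one. *)
Definition gap p q : R := pos (p.1 + 1) + pos (1 - q.1).

Lemma lensP p : lens p -> [/\ -2 <= p.1, p.1 <= 2, 0 <= p.2 &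
  p.2 <= k * (1 - clamp p.1 ^+ 2)].
Proof. by case/andP => /andP[? ?] /andP[]. Qed.

Lemma absc0 p q : absc p q 0 = p.1. Proof. by rewrite /absc mul0r addr0. Qed.
Lemma absc1 p q : absc p q 1 = q.1.
Proof. by rewrite /absc mul1r addrC subrK. Qed.

Lemma absc_itv p q t (a b : R) : 0 <= t <= 1 ->
  a <= p.1 <= b -> a <= q.1 <= b -> a <= absc p q t <= b.
Proof.
move=> /andP[t0 t1] /andP[ap pb] /andP[aq qb]; rewrite /absc.
have h1 : 0 <= t * (q.1 - a) by rewrite mulr_ge0// subr_ge0.
have h2 : 0 <= (1 - t) * (p.1 - a) by rewrite mulr_ge0// subr_ge0.
have h3 : 0 <= t * (b - q.1) by rewrite mulr_ge0// subr_ge0.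
have h4 : 0 <= (1 - t) * (b - p.1) by rewrite mulr_ge0// subr_ge0.
by apply/andP; split; lra.
Qed.

Lemma clamp_between (x y z : R) :
  x <= z <= y -> clamp x <= clamp z <= clamp y.
Proof. by case/andP => ? ?; rewrite !clamp_mono. Qed.

Lemma clamp_absc p q t : 0 <= t <= 1 ->
  clamp (absc p q t) = clamp p.1 + share p q t * (clamp q.1 - clamp p.1).
Proof.
move=> t01; rewrite /share; case: eqVneq => [E|ne].
  rewrite E subrr mulr0 addr0.
  have [pq|/ltW qp] := leP p.1 q.1.
    have /clamp_between : p.1 <= absc p q t <= q.1.
      by apply: absc_itv => //; rewrite lexx ?pq.
    by rewrite E => /andP[? ?]; apply/le_anti/andP.
  have /clamp_between : q.1 <= absc p q t <= p.1.
    by apply: absc_itv => //; rewrite lexx ?qp.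
  by rewrite E => /andP[? ?]; apply/le_anti/andP.
by rewrite divfK ?subr_eq0 1?eq_sym// addrC subrK.
Qed.

Lemma share01 p q t : 0 <= t <= 1 -> 0 <= share p q t <= 1.
Proof.
move=> t01; rewrite /share; case: eqVneq => // ne.
have [pq|/ltW qp] := leP p.1 q.1.
  have /clamp_between/andP[h1 h2] : p.1 <= absc p q t <= q.1.
    by apply: absc_itv => //; rewrite lexx ?pq.
  have lt : 0 < clamp q.1 - clamp p.1.
    by rewrite subr_gt0 lt_neqAle ne clamp_mono.
  by rewrite ler_pdivrMr// divr_ge0 ?subr_ge0 ?(ltW lt)//=; lra.
have /clamp_between/andP[h1 h2] : q.1 <= absc p q t <= p.1.
  by apply: absc_itv => //; rewrite lexx ?qp.
have lt : 0 < clamp p.1 - clamp q.1.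
  by rewrite subr_gt0 lt_neqAle eq_sym ne clamp_mono.
rewrite -mulrNN -invrN !opprB ler_pdivrMr// divr_ge0 ?subr_ge0 ?(ltW lt)//=; lra.
Qed.

Lemma share0 p q : share p q 0 = 0.
Proof. by rewrite /share; case: eqP => // _; rewrite absc0 subrr mul0r. Qed.

Lemma share1 p q : share p q 1 = 1.
Proof.
rewrite /share; case: eqVneq => // ne.
by rewrite absc1 divff// subr_eq0 eq_sym.
Qed.

Lemma bulge_cases p q : bulge p q = 0 \/ (p.1 < -1 /\ 1 < q.1).
Proof.
have [h|h] := leP (-1) p.1.
  by left; rewrite /bulge; case: (posP (-1 - p.1)) => -[] h1 h2;
    rewrite h2 ?mul0r ?mulr0//; (have -> : -1 - p.1 = 0 by lra);
    rewrite mul0r mulr0.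
have [h'|h'] := leP q.1 1; last by right.
left; rewrite /bulge; case: (posP (q.1 - 1)) => -[] h1 h2;
  rewrite h2 ?mulr0//; (have -> : q.1 - 1 = 0 by lra); by rewrite !mulr0.
Qed.

Lemma lens_end p : lens p -> 1 <= `|p.1| -> p.2 = 0.
Proof.
move=> /lensP[_ _ h0 h1]; rewrite ler_normr => h.
have E : clamp p.1 ^+ 2 = 1.
  case/orP: h => h; case: (clampP p.1) => -[h2 ->]; rewrite ?sqrrN ?expr1n//; try lra.
    have -> : p.1 = 1 by lra.
    by rewrite expr1n.
  have -> : p.1 = -1 by lra.
  by rewrite sqrrN expr1n.
by move: h1; rewrite E; lra.
Qed.

Lemma bulge_bound p q : lens p -> lens q -> 0 <= bulge p q <= k.
Proof.
move=> /lensP[p1 _ _ _] /lensP[_ q1 _ _].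
have k0 := thin_gt0.
have hp : 0 <= pos (-1 - p.1) <= 1.
  by case: (posP (-1 - p.1)) => -[] ? ->; apply/andP; split; lra.
have hq : 0 <= pos (q.1 - 1) <= 1.
  by case: (posP (q.1 - 1)) => -[] ? ->; apply/andP; split; lra.
case/andP: hp => ? ?; case/andP: hq => ? ?; rewrite /bulge.
have h1 : 0 <= pos (-1 - p.1) * pos (q.1 - 1) by exact: mulr_ge0.
have h2 : pos (-1 - p.1) * pos (q.1 - 1) <= 1 by exact: mulr_ile1.
by rewrite (mulr_ge0 (ltW k0) h1)/= ler_piMr// ltW.
Qed.

Lemma bulge_ends p q : lens p -> lens q -> bulge p q = 0 \/ (p.2 = 0 /\ q.2 = 0).
Proof.
move=> Xp Xq; case: (bulge_cases p q) => [|[h1 h2]]; first by left.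
right; split; apply: lens_end => //.
  by rewrite ler_normr; apply/orP; right; lra.
by rewrite ler_normr; apply/orP; left; lra.
Qed.

(** Without bulge this is concavity of [1 - b ^ 2]; with bulge both endpoints
    have height 0 and the path is a scaled copy of the upper boundary. *)
Lemma trace_lens p q t : lens p -> lens q -> 0 <= t <= 1 -> lens (trace p q t).
Proof.
move=> Xp Xq t01; apply/andP; split.
  by apply: absc_itv => //; [case/andP: Xp|case/andP: Xq].
rewrite /width /=.
have /lensP[_ _ p0 p1] := Xp; have /lensP[_ _ q0 q1] := Xq.
have /andP[c0 c1] := bulge_bound Xp Xq.
have k0 := thin_gt0.
have /andP[r0 r1] := share01 p q t01.
have [lo hi] := clamp_bound (absc p q t).
have C : 0 <= 1 - clamp (absc p q t) ^+ 2.
  have : 0 <= (1 - clamp (absc p q t)) * (1 + clamp (absc p q t)).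
    by rewrite mulr_ge0//; lra.
  by lra.
rewrite /height; case: (bulge_ends Xp Xq) => [->|[-> ->]].
  rewrite mul0r addr0 (clamp_absc p q t01).
  clear C lo hi c0 c1 t01 Xp Xq.
  move: (share p q t) (clamp p.1) (clamp q.1) k p.2 q.2 k0 r0 r1 p0 q0 p1 q1.
  move=> r x y c u v k0 r0 r1 p0 q0 p1 q1.
  have h1 : 0 <= r * v by rewrite mulr_ge0.
  have h2 : 0 <= (1 - r) * u by rewrite mulr_ge0// subr_ge0.
  have h3 : 0 <= r * (c * (1 - y ^+ 2) - v) by rewrite mulr_ge0// subr_ge0.
  have h4 : 0 <= (1 - r) * (c * (1 - x ^+ 2) - u) by rewrite mulr_ge0// subr_ge0.
  have h5 : 0 <= c * (r * (1 - r) * (x - y) ^+ 2).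
    apply: mulr_ge0; first exact: ltW.
    by apply: mulr_ge0; rewrite ?sqr_ge0// mulr_ge0// subr_ge0.
  by apply/andP; split; lra.
rewrite subrr mulr0 !add0r mulr_ge0//=.
by rewrite ler_wpM2r.
Qed.

Lemma trace0 p q : lens p -> lens q -> trace p q 0 = p.
Proof.
move=> Xp Xq; rewrite /trace /height absc0 share0 mul0r addr0.
suff -> : bulge p q * (1 - clamp p.1 ^+ 2) = 0 by rewrite addr0; case: (p).
case: (bulge_cases p q) => [->|[h _]]; first by rewrite mul0r.
by case: (clampP p.1) => -[] h1 ->; rewrite ?sqrrN ?expr1n ?subrr ?mulr0//; lra.
Qed.

Lemma trace1 p q : lens p -> lens q -> trace p q 1 = q.
Proof.
move=> Xp Xq; rewrite /trace /height absc1 share1 mul1r [p.2 + _]addrC subrK.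
suff -> : bulge p q * (1 - clamp q.1 ^+ 2) = 0 by rewrite addr0; case: (q).
case: (bulge_cases p q) => [->|[_ h]]; first by rewrite mul0r.
by case: (clampP q.1) => -[] h1 ->; rewrite ?sqrrN ?expr1n ?subrr ?mulr0//; lra.
Qed.

Lemma gap_ge0 p q : 0 <= gap p q. Proof. by rewrite addr_ge0// pos_ge0. Qed.

Lemma gap_le p q : lens p -> lens q -> gap p q <= 6.
Proof.
move=> /lensP[p0 p1 _ _] /lensP[q0 q1 _ _]; rewrite /gap.
by case: (posP (p.1 + 1)) => -[] ? ->; case: (posP (1 - q.1)) => -[] ? ->; lra.
Qed.

Lemma clamp_gap p q : clamp p.1 + 1 <= gap p q /\ 1 - clamp q.1 <= gap p q.
Proof.
have := pos_ge0 (p.1 + 1); have := pos_ge0 (1 - q.1); rewrite /gap.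
by split; [case: (clampP p.1)|case: (clampP q.1)] => -[h ->];
  case: (posP (p.1 + 1)) => -[] ? ->; case: (posP (1 - q.1)) => -[] ? ->; lra.
Qed.

Lemma lens_gap p q : lens p -> lens q ->
  p.2 <= 2 * k * gap p q /\ q.2 <= 2 * k * gap p q.
Proof.
move=> /lensP[_ _ _ hp] /lensP[_ _ _ hq].
have [gp gq] := clamp_gap p q; have k0 := thin_gt0.
have [? ?] := clamp_bound p.1; have [? ?] := clamp_bound q.1.
have h1 : 0 <= k * ((1 + clamp p.1) * (1 + clamp p.1)).
  by rewrite !mulr_ge0 ?(ltW k0)//; lra.
have h2 : 0 <= k * ((1 - clamp q.1) * (1 - clamp q.1)).
  by rewrite !mulr_ge0 ?(ltW k0)//; lra.
have h3 : 0 <= k * (gap p q - (clamp p.1 + 1)) by rewrite mulr_ge0 ?(ltW k0)//; lra.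
have h4 : 0 <= k * (gap p q - (1 - clamp q.1)) by rewrite mulr_ge0 ?(ltW k0)//; lra.
split; lra.
Qed.

(** The slope of a path issuing from a tip: dividing
    [k (1 - y ^ 2) = k (1 - y) (1 + y)] by the distance to the tip leaves [k]
    times the distance to the opposite tip, which is at most the gap. *)
Lemma slope_end p q : lens p -> lens q -> 1 <= `|p.1| \/ 1 <= `|q.1| ->
  `|q.2 - p.2| <= k * gap p q * `|clamp q.1 - clamp p.1|.
Proof.
move=> Xp Xq; have k0 := thin_gt0.
have g0 := gap_ge0 p q; have [gp gq] := clamp_gap p q.
have [? ?] := clamp_bound p.1; have [? ?] := clamp_bound q.1.
(* [e] is the tip, [(y, v)] the other endpoint. *)
have main (e x y v : R) : `|e| = 1 -> -1 <= y <= 1 -> x = e ->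
    0 <= v -> v <= k * (1 - y ^+ 2) ->
    1 + e * y <= gap p q -> v <= k * gap p q * `|y - x|.
  move=> e1 /andP[y0 y1] -> v0 vy eg; apply: (le_trans vy).
  have -> : 1 - y ^+ 2 = (1 + e * y) * (1 - e * y).
    have : e ^+ 2 = 1 by rewrite -real_normK ?num_real// e1 expr1n.
    by move=> e2; rewrite -[LHS]mul1r; ring: e2.
  have -> : `|y - e| = 1 - e * y.
    have [->|->] : e = 1 \/ e = -1.
      by move/eqP: e1; rewrite eqr_norml => /andP[/orP[]/eqP-> _]; [left|right].
    - by rewrite distrC ger0_norm; lra.
    - by rewrite ger0_norm; lra.
  rewrite -mulrA ler_pM2l// ler_wpM2r//.
  have : e * y <= 1.
    rewrite (le_trans (ler_norm _))// normrM e1 mul1r ler_norml; lra.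
  by lra.
have sgn (x : R) : 1 <= `|x| -> (clamp x = 1 /\ 1 <= x) \/ (clamp x = -1 /\ x <= -1).
  rewrite ler_normr => /orP[] h; [left|right];
    by case: (clampP x) => -[h' ->]; split; lra.
have gap2 (x : R) : 1 <= x -> 2 <= pos (x + 1).
  by move=> ?; case: (posP (x + 1)) => -[] ? ->; lra.
have gap2' (x : R) : x <= -1 -> 2 <= pos (1 - x).
  by move=> ?; case: (posP (1 - x)) => -[] ? ->; lra.
have P1 := pos_ge0 (p.1 + 1); have P2 := pos_ge0 (1 - q.1).
case=> h.
  rewrite (lens_end Xp h) subr0; have /lensP[_ _ q0 q1] := Xq.
  rewrite ger0_norm//; case: (sgn _ h) => -[E h'].
    apply: (main 1) => //; rewrite ?normr1//; first by apply/andP.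
    by have := gap2 _ h'; rewrite /gap; lra.
  apply: (main (-1)) => //; rewrite ?normrN ?normr1//; first by apply/andP.
  by lra.
rewrite (lens_end Xq h) sub0r normrN; have /lensP[_ _ q0 q1] := Xp.
rewrite ger0_norm// distrC; case: (sgn _ h) => -[E h'].
  apply: (main 1) => //; rewrite ?normr1//; first by apply/andP.
  by lra.
apply: (main (-1)) => //; rewrite ?normrN ?normr1//; first by apply/andP.
by have := gap2' _ h'; rewrite /gap; lra.
Qed.

Lemma slope_end_clamp p q : lens p -> lens q ->
  1 <= `|p.1| \/ 1 <= `|q.1| -> clamp p.1 = clamp q.1 -> p.2 = q.2.
Proof.
move=> Xp Xq h E; have := slope_end Xp Xq h.
by rewrite E subrr normr0 mulr0 normr_le0 subr_eq0 => /eqP.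
Qed.

Lemma ends_cases p q : (`|p.1| <= 1 /\ `|q.1| <= 1) \/ (1 <= `|p.1| \/ 1 <= `|q.1|).
Proof.
have [hp|/ltW hp] := leP `|p.1| 1; last by right; left.
have [hq|/ltW hq] := leP `|q.1| 1; last by right; right.
by left.
Qed.

Lemma share_core p q t : `|p.1| <= 1 -> `|q.1| <= 1 -> 0 <= t <= 1 -> share p q t = t.
Proof.
move=> hp hq t01; rewrite /share; case: eqVneq => // ne.
rewrite !clamp_id//.
  rewrite /absc [p.1 + _]addrC addrK mulfK//.
  by move: ne; rewrite !clamp_id// subr_eq0 eq_sym.
rewrite ler_norml; apply: absc_itv => //; by rewrite -ler_norml.
Qed.

Lemma bulge_core p q : `|p.1| <= 1 -> bulge p q = 0.
Proof.
by rewrite ler_norml => /andP[? ?]; case: (bulge_cases p q) => [//|[]]; lra.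
Qed.

(** A path inside the lens is a segment.  Any other path has slope less than 1,
    so only its affine abscissa is seen by the norm. *)
Lemma trace_isometry p q t s : lens p -> lens q -> 0 <= t <= 1 -> 0 <= s <= 1 ->
  nrm (absc p q t - absc p q s) (height p q t - height p q s) =
  `|t - s| * nrm (q.1 - p.1) (q.2 - p.2).
Proof.
move=> Xp Xq t01 s01.
have bE : absc p q t - absc p q s = (t - s) * (q.1 - p.1) by rewrite /absc; ring.
case: (ends_cases p q) => [[hp hq]|h].
  rewrite -nrmZ -bE; congr nrm.
  by rewrite /height !share_core// bulge_core//; ring.
have flat (t' s' : R) : 0 <= t' <= 1 -> 0 <= s' <= 1 ->
    `|height p q t' - height p q s'| <= `|absc p q t' - absc p q s'|.
  move=> t'01 s'01.
  have L := clamp_lip (absc p q t') (absc p q s').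
  apply: le_trans L.
  have -> : height p q t' - height p q s' =
    (share p q t' - share p q s') * (q.2 - p.2) +
    bulge p q * ((clamp (absc p q s') + clamp (absc p q t')) *
      (clamp (absc p q s') - clamp (absc p q t'))) by rewrite /height; ring.
  apply: (le_trans (ler_normD _ _)).
  have g6 := gap_le Xp Xq; have g0 := gap_ge0 p q.
  have h1 : `|(share p q t' - share p q s') * (q.2 - p.2)| <=
      k * gap p q * `|clamp (absc p q t') - clamp (absc p q s')|.
    rewrite normrM !clamp_absc//.
    have -> : clamp p.1 + share p q t' * (clamp q.1 - clamp p.1) -
      (clamp p.1 + share p q s' * (clamp q.1 - clamp p.1)) =
      (share p q t' - share p q s') * (clamp q.1 - clamp p.1) by ring.
    rewrite normrM mulrCA ler_wpM2l//; exact: slope_end.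
  have /andP[c0 c1] := bulge_bound Xp Xq.
  have [? ?] := clamp_bound (absc p q t'); have [? ?] := clamp_bound (absc p q s').
  have h2 : `|bulge p q * ((clamp (absc p q s') + clamp (absc p q t')) *
      (clamp (absc p q s') - clamp (absc p q t')))| <=
      k * (2 * `|clamp (absc p q t') - clamp (absc p q s')|).
    rewrite normrM [X in _ * X]normrM [`|bulge p q|]ger0_norm//.
    rewrite [X in _ * (_ * X) <= _]distrC.
    apply: ler_pM => //.
    by apply: ler_wpM2r => //; rewrite ler_norml; lra.
  apply: le_trans (lerD h1 h2) _.
  set D := `|_|; have D0 : 0 <= D by exact: normr_ge0.
  have : 0 <= D * (6 - gap p q) by rewrite mulr_ge0//; lra.
  by rewrite thinE; lra.
rewrite nrm_flat ?flat//.
have := flat 1 0 ltac:(lra) ltac:(lra).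
rewrite absc0 absc1.
have -> : height p q 1 = q.2 by rewrite -[RHS](f_equal snd (trace1 Xp Xq)).
have -> : height p q 0 = p.2 by rewrite -[RHS](f_equal snd (trace0 Xp Xq)).
by move=> h'; rewrite nrm_flat// bE normrM.
Qed.

(** This confines the steep differences, the only delicate ones, to the interior
    of the lens; in particular the kinks of paths at the tips do no harm. *)
Lemma flat_at_end p q : lens p -> lens q -> 1 <= `|p.1| -> `|p.2 - q.2| <= `|p.1 - q.1|.
Proof.
move=> Xp Xq h.
have := slope_end Xp Xq (or_introl h); rewrite distrC => H; apply: (le_trans H).
have := clamp_lip q.1 p.1; rewrite [leRHS]distrC => L; apply: le_trans L.
have g6 := gap_le Xp Xq; have g0 := gap_ge0 p q.
set D := `|_|; have D0 : 0 <= D by exact: normr_ge0.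
have : 0 <= D * (6 - gap p q) by rewrite mulr_ge0//; lra.
by rewrite thinE; lra.
Qed.

(** Inside the lens a path is a segment plus its arc, and the segment is low and
    nearly horizontal when the path almost joins the two antennas. *)
Lemma height_core p q : lens p -> lens q -> exists A B : R,
  `|B| <= 4 * k * gap p q /\
  forall t, 0 <= t <= 1 -> `|absc p q t| <= 1 ->
    height p q t = A + B * t + bulge p q * (1 - absc p q t ^+ 2) /\
    `|A + B * t| <= 2 * k * gap p q.
Proof.
move=> Xp Xq; have k0 := thin_gt0; have g0 := gap_ge0 p q.
have [up uq] := lens_gap Xp Xq.
have /lensP[p1 p2 p0 _] := Xp; have /lensP[q1 q2 q0 _] := Xq.
have kg0 : 0 <= k * gap p q by rewrite mulr_ge0 ?(ltW k0).
have : exists B : R, `|B| <= 4 * k * gap p q /\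
    exists A : R, forall t, 0 <= t <= 1 -> `|absc p q t| <= 1 ->
    p.2 + share p q t * (q.2 - p.2) = A + B * t.
  have B0 : `|q.2 - p.2| <= 4 * k * gap p q by rewrite ler_norml; lra.
  case: (ends_cases p q) => [[hp hq]|h].
    exists (q.2 - p.2); split => //.
    by exists p.2 => t t01 _; rewrite share_core// mulrC.
  case: (eqVneq (clamp p.1) (clamp q.1)) => [E|ne].
    exists 0; split; first by rewrite normr0; lra.
    exists p.2 => t _ _.
    by rewrite (slope_end_clamp Xp Xq h E) subrr mulr0 mul0r.
  have d0 : clamp q.1 - clamp p.1 != 0 by rewrite subr_eq0 eq_sym.
  exists ((q.1 - p.1) * ((q.2 - p.2) / (clamp q.1 - clamp p.1))); split.
    rewrite normrM.
    have -> : 4 * k * gap p q = 4 * (k * gap p q) by ring.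
    apply: ler_pM => //; first by rewrite ler_norml; lra.
    by rewrite normrM normfV ler_pdivrMr ?normr_gt0//; exact: slope_end.
  exists (p.2 + (p.1 - clamp p.1) / (clamp q.1 - clamp p.1) * (q.2 - p.2)) => t _ h1.
  rewrite /share (negbTE ne) (clamp_id h1) /absc.
  by field.
move=> [B [hB [A HA]]]; exists A, B; split => // t t01 h1.
rewrite -HA//; split; first by rewrite /height clamp_id.
have /andP[r0 r1] := share01 p q t01.
move: (share p q t) r0 r1 => r r0 r1.
have h2 : 0 <= (1 - r) * p.2 by rewrite mulr_ge0 ?subr_ge0.
have h3 : 0 <= r * q.2 by rewrite mulr_ge0.
have h4 : 0 <= (1 - r) * (2 * k * gap p q - p.2) by rewrite mulr_ge0 ?subr_ge0.
have h5 : 0 <= r * (2 * k * gap p q - q.2) by rewrite mulr_ge0 ?subr_ge0.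
by rewrite ler_norml; lra.
Qed.

End Lens.

(** * Supporting lines for the distance between two paths *)

Section Convexity.
Context {R : realType}.
Implicit Types (p q : R * R) (b t s : R).
Notation k := (@thin R).

Definition spread p q p' q' : R := `|p'.1 - p.1| + `|q'.1 - q.1|.

Lemma bulge_lip p q p' q' : lens p -> lens q -> lens p' -> lens q' ->
  `|bulge p' q' - bulge p q| <= k * spread p q p' q'.
Proof.
move=> /lensP[? _ _ _] /lensP[_ ? _ _] /lensP[? _ _ _] /lensP[_ ? _ _].
rewrite /bulge /spread -mulrBr normrM (ger0_norm (ltW thin_gt0)).
apply: ler_wpM2l; first exact: ltW thin_gt0.
have L1 := pos_lip (-1 - p'.1) (-1 - p.1).
have L2 := pos_lip (q'.1 - 1) (q.1 - 1).
have E1 : `|-1 - p'.1 - (-1 - p.1)| = `|p'.1 - p.1| by rewrite -normrN; congr `|_|; ring.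
have E2 : q'.1 - 1 - (q.1 - 1) = q'.1 - q.1 by ring.
rewrite E1 in L1; rewrite E2 in L2.
have b1 : `|pos (-1 - p.1)| <= 1.
  by rewrite ger0_norm ?pos_ge0//; case: (posP (-1 - p.1)) => -[] ? ->; lra.
have b2 : `|pos (q'.1 - 1)| <= 1.
  by rewrite ger0_norm ?pos_ge0//; case: (posP (q'.1 - 1)) => -[] ? ->; lra.
have -> : pos (-1 - p'.1) * pos (q'.1 - 1) - pos (-1 - p.1) * pos (q.1 - 1) =
  (pos (-1 - p'.1) - pos (-1 - p.1)) * pos (q'.1 - 1) +
  pos (-1 - p.1) * (pos (q'.1 - 1) - pos (q.1 - 1)) by ring.
apply: le_trans (ler_normD _ _) _; rewrite !normrM lerD//.
  by rewrite -[leRHS]mulr1 ler_pM.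
by rewrite -[leRHS]mul1r ler_pM.
Qed.

(** If one path is a proper arc, its own gap is 0, so the gap of the other path
    is bounded by the distance between the abscissas of the endpoints. *)
Lemma gap_spread p q p' q' : bulge p q != 0 ->
  gap p q = 0 /\ gap p' q' <= spread p q p' q'.
Proof.
case: (bulge_cases p q) => [->|[h1 h2] _]; first by rewrite eqxx.
have z1 : pos (p.1 + 1) = 0 by case: (posP (p.1 + 1)) => -[] ? ->; lra.
have z2 : pos (1 - q.1) = 0 by case: (posP (1 - q.1)) => -[] ? ->; lra.
rewrite /gap z1 z2 addr0; split => //.
have L1 := pos_lip (p'.1 + 1) (p.1 + 1); have L2 := pos_lip (1 - q'.1) (1 - q.1).
rewrite z1 subr0 ger0_norm ?pos_ge0// in L1.
rewrite z2 subr0 ger0_norm ?pos_ge0// in L2.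
have E1 : p'.1 + 1 - (p.1 + 1) = p'.1 - p.1 by ring.
have E2 : `|1 - q'.1 - (1 - q.1)| = `|q'.1 - q.1| by rewrite -normrN; congr `|_|; ring.
by rewrite E1 in L1; rewrite E2 in L2; exact: lerD.
Qed.

Lemma spreadC p q p' q' : spread p' q' p q = spread p q p' q'.
Proof. by rewrite /spread distrC [`|q.1 - _|]distrC. Qed.

(** An affine function with a small value somewhere on [[0, 1]] has end values
    bounded by its slope, up to that small value. *)
Lemma spread_le p q p' q' t : 0 <= t <= 1 ->
  spread p q p' q' <= `|(q'.1 - p'.1) - (q.1 - p.1)| +
    2 * `|absc p' q' t - absc p q t|.
Proof.
move=> /andP[t0 t1].
set db := _ - _ - _; set s := absc _ _ _ - _.
have E1 : p'.1 - p.1 = s - t * db by rewrite /s /db /absc; ring.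
have E2 : q'.1 - q.1 = s + (1 - t) * db by rewrite /s /db /absc; ring.
rewrite /spread E1 E2.
have := ler_normB s (t * db); have := ler_normD s ((1 - t) * db).
rewrite !normrM (ger0_norm t0) (@ger0_norm _ (1 - t)) ?subr_ge0//.
by lra.
Qed.

Definition fdist p q p' q' t : R :=
  nrm (absc p' q' t - absc p q t) (height p' q' t - height p q t).

Lemma absc_shift p q p' q' t0 t :
  absc p' q' t - absc p q t = (absc p' q' t0 - absc p q t0) +
    ((q'.1 - p'.1) - (q.1 - p.1)) * (t - t0).
Proof. by rewrite /absc; ring. Qed.

Lemma supported_flat p q p' q' t0 :
  `|height p' q' t0 - height p q t0| <= `|absc p' q' t0 - absc p q t0| ->
  supported_at (fdist p q p' q') t0.
Proof.
move=> flat.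
set s := absc p' q' t0 - absc p q t0 in flat.
set db := (q'.1 - p'.1) - (q.1 - p.1).
exists (Num.sg s * db), 1; split => // t _.
rewrite {1}/fdist nrm_flat//.
apply: (@le_trans _ _ `|absc p' q' t - absc p q t|); last first.
  by rewrite /fdist le_max lexx.
rewrite (absc_shift p q p' q' t0 t) -/s -/db.
rewrite [`|s|]normrEsg -mulrA -mulrDr.
apply: (le_trans (ler_norm _)); rewrite normrM -[leRHS]mul1r ler_wpM2r//.
by rewrite normr_sg; case: eqP.
Qed.

Lemma core_near p q t0 : lens p -> lens q -> `|absc p q t0| < 1 ->
  exists2 e : R, 0 < e & forall t, `|t - t0| < e -> `|absc p q t| <= 1.
Proof.
move=> /lensP[p1 p2 _ _] /lensP[q1 q2 _ _] h.
exists ((1 - `|absc p q t0|) / 4); first by lra.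
move=> t ht.
have -> : absc p q t = absc p q t0 + (q.1 - p.1) * (t - t0) by rewrite /absc; ring.
apply: le_trans (ler_normD _ _) _; rewrite normrM.
have : `|q.1 - p.1| * `|t - t0| <= 4 * ((1 - `|absc p q t0|) / 4).
  by apply: ler_pM => //; [rewrite ler_norml; lra|exact: ltW].
by lra.
Qed.

Lemma steep_core p q p' q' t : lens p -> lens q -> lens p' -> lens q' ->
  0 <= t <= 1 ->
  `|absc p' q' t - absc p q t| < `|height p' q' t - height p q t| ->
  `|absc p q t| < 1 /\ `|absc p' q' t| < 1.
Proof.
move=> Xp Xq Xp' Xq' t01 st.
have X := trace_lens Xp Xq t01; have X' := trace_lens Xp' Xq' t01.
split; rewrite ltNge; apply/negP => h; move: st; rewrite ltNge => /negP; apply.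
  by rewrite distrC [leRHS]distrC; exact: (flat_at_end X X' h).
exact: (flat_at_end X' X h).
Qed.

(** Here [e] bounds the differences of abscissas and of speeds of two paths; the
    segment parts and the difference of the bulges are of order [k e].  The
    conclusion bounds the coefficients, in powers of the elapsed time, of the
    difference of the heights [A + B t + c (1 - b ^ 2)] and
    [A' + B' t + c' (1 - b' ^ 2)], where [b], [b'] move with speeds [l], [l']. *)
Lemma coeff_bounds (e b b' l l' c c' A B A' B' t : R) :
  0 <= e ->
  `|b| <= 1 -> `|b'| <= 1 -> `|l| <= 4 -> `|l'| <= 4 ->
  `|b' - b| <= e -> `|l' - l| <= e ->
  0 <= c <= k -> `|c' - c| <= k * e ->
  `|A + B * t| <= 2 * k * e -> `|A' + B' * t| <= 2 * k * e ->
  `|B| <= 4 * k * e -> `|B'| <= 4 * k * e ->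
  [/\ `|(A' + B' * t + c' * (1 - b' ^+ 2)) - (A + B * t + c * (1 - b ^+ 2))| <= e / 20,
      `|(B' - 2 * c' * b' * l') - (B - 2 * c * b * l)| <= e / 20
    & `|c * l ^+ 2 - c' * l' ^+ 2| <= e / 20].
Proof.
move=> e0 hb hb' hl hl' bb ll /andP[c0 ck] cc hA hA' hB hB'.
have k0 := @thin_gt0 R.
have prod (x y u v : R) : `|x| <= u -> `|y| <= v -> `|x * y| <= u * v.
  by move=> hx hy; rewrite normrM ler_pM.
have hc : `|c| <= k by rewrite ger0_norm.
split.
- have b1 : `|1 - b' ^+ 2| <= 1.
    rewrite ler_norml; have := sqr_ge0 b'; have : b' ^+ 2 <= 1.
      by rewrite -real_normK ?num_real// expr_le1.
    by lra.
  have b2 : `|b + b'| <= 2 by apply: le_trans (ler_normD _ _) _; lra.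
  have h1 := prod _ _ _ _ cc b1.
  have h2 := prod _ _ _ _ hc (prod _ _ _ _ b2 bb).
  have -> : A' + B' * t + c' * (1 - b' ^+ 2) - (A + B * t + c * (1 - b ^+ 2)) =
    (A' + B' * t) - (A + B * t) + ((c' - c) * (1 - b' ^+ 2) - c * ((b + b') * (b' - b))).
    by ring.
  move: h1 h2 hA hA'; move: ((c' - c) * (1 - b' ^+ 2)) (c * _) (A + B * t) (A' + B' * t).
  move=> x y z w; rewrite !ler_norml thinE => *; lra.
- have h1 := prod _ _ _ _ cc (prod _ _ _ _ hb' hl').
  have h2 := prod _ _ _ _ hc (prod _ _ _ _ bb hl').
  have h3 := prod _ _ _ _ hc (prod _ _ _ _ hb ll).
  have -> : B' - 2 * c' * b' * l' - (B - 2 * c * b * l) =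
    B' - B - 2 * ((c' - c) * (b' * l') + c * ((b' - b) * l') + c * (b * (l' - l))).
    by ring.
  move: h1 h2 h3 hB hB'.
  move: ((c' - c) * (b' * l')) (c * ((b' - b) * l')) (c * (b * (l' - l))) => x y z.
  rewrite !ler_norml thinE => *; lra.
- have l2 : `|l + l'| <= 8 by apply: le_trans (ler_normD _ _) _; lra.
  have h1 := prod _ _ _ _ cc (prod _ _ _ _ hl' hl').
  have h2 := prod _ _ _ _ hc (prod _ _ _ _ l2 ll).
  have -> : c * l ^+ 2 - c' * l' ^+ 2 = - ((c' - c) * (l' * l')) - c * ((l + l') * (l' - l)).
    by ring.
  move: h1 h2; move: ((c' - c) * (l' * l')) (c * _) => x y.
  by rewrite !ler_norml thinE => *; lra.
Qed.

Lemma supported_steep p q p' q' t0 : lens p -> lens q -> lens p' -> lens q' ->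
  0 < t0 < 1 ->
  `|absc p' q' t0 - absc p q t0| < `|height p' q' t0 - height p q t0| ->
  supported_at (fdist p q p' q') t0.
Proof.
move=> Xp Xq Xp' Xq' /andP[t0_gt0 t0_lt1] st.
have t01 : 0 <= t0 <= 1 by rewrite !ltW.
have [h h'] := steep_core Xp Xq Xp' Xq' t01 st.
have [e e0 he] := core_near Xp Xq h.
have [e' e'0 he'] := core_near Xp' Xq' h'.
have [A [B [hB HA]]] := height_core Xp Xq.
have [A' [B' [hB' HA']]] := height_core Xp' Xq'.
set db := (q'.1 - p'.1) - (q.1 - p.1).
set s0 := absc p' q' t0 - absc p q t0 in st.
set c := bulge p q in HA; set c' := bulge p' q' in HA'.
set b := absc p q t0; set b' := absc p' q' t0.
set l := q.1 - p.1; set l' := q'.1 - p'.1.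
pose g0 := (A' + B' * t0 + c' * (1 - b' ^+ 2)) - (A + B * t0 + c * (1 - b ^+ 2)).
pose g1 := (B' - 2 * c' * b' * l') - (B - 2 * c * b * l).
pose g2 := c * l ^+ 2 - c' * l' ^+ 2.
have gE t : 0 <= t <= 1 -> `|absc p q t| <= 1 -> `|absc p' q' t| <= 1 ->
    height p' q' t - height p q t = g0 + g1 * (t - t0) + g2 * (t - t0) ^+ 2.
  move=> tt k1 k2; have [-> _] := HA t tt k1; have [-> _] := HA' t tt k2.
  by rewrite /g0 /g1 /g2 /b /b' /l /l' /absc; ring.
have g0E : height p' q' t0 - height p q t0 = g0.
  by rewrite gE ?(ltW h) ?(ltW h')// subrr expr0n/= !mulr0 !addr0.
rewrite g0E in st.
have [|m hm] := @ell_support R s0 db g0 g1 g2 st.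
  have [[cz cz']|cz] : (c = 0 /\ c' = 0) \/ (c != 0 \/ c' != 0).
    by case: (eqVneq c 0); case: (eqVneq c' 0); auto.
    by left; rewrite /g2 cz cz' !mul0r subrr.
  right.
  have S0 : 0 <= spread p q p' q' by rewrite addr_ge0.
  have k0 := @thin_gt0 R.
  have [G G'] : gap p q <= spread p q p' q' /\ gap p' q' <= spread p q p' q'.
    case: cz => cz.
      by have [-> ?] := gap_spread p' q' cz.
    by have [-> ] := gap_spread p q cz; rewrite spreadC.
  have kG : k * gap p q <= k * spread p q p' q' by rewrite ler_pM2l.
  have kG' : k * gap p' q' <= k * spread p q p' q' by rewrite ler_pM2l.
  have [_ vA] := HA t0 t01 (ltW h); have [_ vA'] := HA' t0 t01 (ltW h').
  have /lensP[? ? _ _] := Xp; have /lensP[? ? _ _] := Xq.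
  have /lensP[? ? _ _] := Xp'; have /lensP[? ? _ _] := Xq'.
  have SB := spread_le p q p' q' t01; rewrite -/db -/s0 in SB.
  have bb : `|b' - b| <= spread p q p' q'.
    have -> : b' - b = (1 - t0) * (p'.1 - p.1) + t0 * (q'.1 - q.1).
      by rewrite /b' /b /absc; ring.
    apply: le_trans (ler_normD _ _) _.
    by rewrite !normrM lerD// ler_piMl// ger0_norm ?subr_ge0 ?gerBl ?ltW.
  have ll : `|l' - l| <= spread p q p' q'.
    have -> : l' - l = (q'.1 - q.1) - (p'.1 - p.1) by rewrite /l /l'; ring.
    by rewrite /spread [leRHS]addrC; exact: ler_normB.
  have hl : `|l| <= 4 by rewrite ler_norml /l; lra.
  have hl' : `|l'| <= 4 by rewrite ler_norml /l'; lra.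
  have e2 : 2 * k * spread p q p' q' = 2 * (k * spread p q p' q') by rewrite mulrA.
  have e4 : 4 * k * spread p q p' q' = 4 * (k * spread p q p' q') by rewrite mulrA.
  have v1 : `|A + B * t0| <= 2 * k * spread p q p' q'.
    by apply: (le_trans vA); rewrite e2 -mulrA ler_pM2l.
  have v2 : `|A' + B' * t0| <= 2 * k * spread p q p' q'.
    by apply: (le_trans vA'); rewrite e2 -mulrA ler_pM2l.
  have v3 : `|B| <= 4 * k * spread p q p' q'.
    by apply: (le_trans hB); rewrite e4 -mulrA ler_pM2l.
  have v4 : `|B'| <= 4 * k * spread p q p' q'.
    by apply: (le_trans hB'); rewrite e4 -mulrA ler_pM2l.
  have [B0 B1 B2] := coeff_bounds S0 (ltW h) (ltW h') hl hl' bb ll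
    (bulge_bound Xp Xq) (bulge_lip Xp Xq Xp' Xq') v1 v2 v3 v4.
  (* Steepness makes [s0] negligible, so the spread comes from the slope [db]. *)
  have sb : spread p q p' q' <= 4 * `|db|.
    have st' : `|s0| <= spread p q p' q' / 20 := ltW (lt_le_trans st B0).
    by move: S0 SB st'; clear; lra.
  have sb' : spread p q p' q' / 20 <= `|db| / 5 by move: sb; clear; lra.
  by split; [exact: le_trans B0 sb'|exact: le_trans B1 sb'|exact: le_trans B2 sb'].
exists m, (Num.min (Num.min e e') (Num.min t0 (1 - t0))); split.
  by rewrite !lt_min e0 e'0 t0_gt0 subr_gt0.
move=> t; rewrite !lt_min => /andP[/andP[te te'] /andP[tt tt']].
have tin : 0 <= t <= 1.
  move: tt tt'; rewrite !ltr_norml => /andP[? ?] /andP[? ?]; apply/andP; split; lra.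
rewrite /fdist g0E -/s0 (nrm_steep (ltW st)).
have t1 : `|t - t0| <= 1 by lra.
apply: (le_trans (hm _ t1)).
rewrite (absc_shift p q p' q' t0 t) -/s0 -/db gE ?he ?he'//.
by rewrite le_max lexx orbT.
Qed.

Lemma supported_fdist p q p' q' t0 : lens p -> lens q -> lens p' -> lens q' ->
  0 < t0 < 1 -> supported_at (fdist p q p' q') t0.
Proof.
move=> Xp Xq Xp' Xq' t01.
have [/supported_flat//|/supported_steep] :=
  leP `|height p' q' t0 - height p q t0| `|absc p' q' t0 - absc p q t0|.
exact.
Qed.

End Convexity.

(** * Continuity *)

Section Continuity.
Context {R : realType}.

Lemma clamp_continuous : continuous (@clamp R).
Proof.
move=> x; apply/cvgrPdist_lt => e e0; near=> y.
apply: le_lt_trans (clamp_lip _ _) _.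
near: y; exact: (@cvgr_dist_lt _ _ _ _ _ id _ (@cvg_id _ _) _ e0).
Unshelve. all: by end_near. Qed.

Lemma nrm_continuous (T : topologicalType) (a b : T -> R) :
  continuous a -> continuous b -> continuous (fun t => nrm (a t) (b t)).
Proof.
move=> ca cb t; apply/cvgrPdist_lt => e e0.
have e2 : 0 < e / 2 by rewrite divr_gt0.
near=> u.
apply: (@le_lt_trans _ _ (`|a t - a u| + `|b t - b u|)).
  have N1 := nrm_triangle (a u) (b u) (a t - a u) (b t - b u).
  have N2 := nrm_triangle (a t) (b t) (a u - a t) (b u - b t).
  have E (x y : R) : x + (y - x) = y by ring.
  rewrite !E in N1; rewrite !E in N2.
  have L := nrm_le (a t - a u) (b t - b u).
  rewrite -(opprB (a t)) -(opprB (b t)) nrmN in N2.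
  by rewrite ler_norml; lra.
rewrite [ltRHS]splitr ltrD//; near: u.
  exact: (cvgr_dist_lt _ _ (ca t) _ e2).
exact: (cvgr_dist_lt _ _ (cb t) _ e2).
Unshelve. all: by end_near. Qed.

Lemma absc_continuous (p q : R * R) : continuous (absc p q).
Proof.
move=> t; apply: cvgD; first exact: cvg_cst.
by apply: cvgM; [exact: cvg_id|exact: cvg_cst].
Qed.

Lemma height_continuous (p q : R * R) : continuous (height p q).
Proof.
have cc : continuous (fun t => clamp (absc p q t)).
  by move=> t; apply: continuous_comp; [exact: absc_continuous|exact: clamp_continuous].
have cr : continuous (share p q).
  move=> t; rewrite /continuous_at /share; case: eqP => _; first exact: cvg_id.
  apply: cvgM; last exact: cvg_cst.
  by apply: cvgB; [exact: cc|exact: cvg_cst].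
move=> t; apply: cvgD.
  apply: cvgD; first exact: cvg_cst.
  by apply: cvgM; [exact: cr|exact: cvg_cst].
apply: cvgM; first exact: cvg_cst.
apply: cvgB; first exact: cvg_cst.
by rewrite /GRing.exp /=; apply: cvgM; exact: cc.
Qed.

Lemma fdist_continuous (p q p' q' : R * R) : continuous (fdist p q p' q').
Proof.
by apply: nrm_continuous => t; apply: cvgB;
  (exact: absc_continuous || exact: height_continuous).
Qed.

End Continuity.

(** * The compact metric space and its bicombing *)

Section Space.
Context (R : realType).
Notation k := (@thin R).

Definition lens_space := {p : R * R | lens p}.
HB.instance Definition _ := Choice.on lens_space.

Implicit Types x y z : lens_space.

Definition lens_dist x y : R := nrm ((val y).1 - (val x).1) ((val y).2 - (val x).2).

Lemma lens_dist_xx x : lens_dist x x = 0.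
Proof. by rewrite /lens_dist !subrr nrm00. Qed.

Lemma lens_dist_eq0 x y : lens_dist x y = 0 -> x = y.
Proof.
case/nrm_eq0 => /eqP; rewrite subr_eq0 => /eqP e1 /eqP; rewrite subr_eq0 => /eqP e2.
by apply: val_inj; rewrite [LHS]surjective_pairing [RHS]surjective_pairing e1 e2.
Qed.

Lemma lens_distC x y : lens_dist x y = lens_dist y x.
Proof. by rewrite /lens_dist -nrmN !opprB. Qed.

Lemma lens_dist_triangle y x z : lens_dist x z <= lens_dist x y + lens_dist y z.
Proof.
rewrite /lens_dist; apply: le_trans (nrm_triangle _ _ _ _).
have E (a b c : R) : b - a + (c - b) = c - a by ring.
by rewrite !E.
Qed.

HB.instance Definition _ := isMetric.Build R lens_space
  lens_dist_xx lens_dist_eq0 lens_distC lens_dist_triangle.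

Lemma mdistE x y : mdist x y = nrm ((val y).1 - (val x).1) ((val y).2 - (val x).2).
Proof. by []. Qed.

(** The default value [x] is only taken at times outside [[0, 1]]. *)
Definition sigma x y (t : R) : lens_space := insubd x (trace (val x) (val y) t).

Lemma val_sigma x y (t : R) : 0 <= t <= 1 -> val (sigma x y t) = trace (val x) (val y) t.
Proof. by move=> t01; rewrite val_insubd trace_lens// ?(valP x) ?(valP y). Qed.

Lemma sigma_bicombing : bicombing sigma.
Proof.
move=> x y; have Xx := valP x; have Xy := valP y.
split.
- by apply: val_inj; rewrite val_sigma ?lexx ?ler01// trace0.
- by apply: val_inj; rewrite val_sigma ?lexx ?ler01// trace1.
move=> s t; rewrite !in_itv/= => s01 t01.
rewrite !mdistE !val_sigma//= trace_isometry// distrC //.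
Qed.

Lemma sigma_convex : convex_bicombing sigma.
Proof.
split; first exact: sigma_bicombing.
move=> x y x' y' l a b; rewrite !inE/= !in_itv/= => a01 b01.
have l01 : 0 <= l%:num <= 1 by rewrite ge0 le1.
have ab01 : 0 <= l%:num * a + (1 - l%:num) * b <= 1.
  case/andP: a01 => ? ?; case/andP: b01 => ? ?; case/andP: l01 => ? ?.
  have h1 : 0 <= l%:num * a by rewrite mulr_ge0.
  have h2 : 0 <= (1 - l%:num) * b by rewrite mulr_ge0 ?subr_ge0.
  have h3 : 0 <= l%:num * (1 - a) by rewrite mulr_ge0 ?subr_ge0.
  have h4 : 0 <= (1 - l%:num) * (1 - b) by rewrite mulr_ge0 ?subr_ge0.
  by apply/andP; split; lra.
have fE t : 0 <= t <= 1 -> mdist (sigma x y t) (sigma x' y' t) =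
    fdist (val x) (val y) (val x') (val y') t.
  by move=> t01; rewrite mdistE !val_sigma.
rewrite (fE _ ab01) (fE _ a01) (fE _ b01).
apply: supported_convex => //; first exact: fdist_continuous.
by move=> t t01; apply: supported_fdist => //; exact: valP.
Qed.

Lemma lens_left : lens ((-2, 0) : R * R).
Proof.
apply/andP; split; first by apply/andP; split => /=; lra.
rewrite /= lexx /width /=.
by case: (clampP (-2 : R)) => -[h ->]; rewrite ?sqrrN ?expr1n ?subrr ?mulr0//; lra.
Qed.

Lemma lens_right : lens ((2, 0) : R * R).
Proof.
apply/andP; split; first by apply/andP; split => /=; lra.
rewrite /= lexx /width /=.
by case: (clampP (2 : R)) => -[h ->]; rewrite ?sqrrN ?expr1n ?subrr ?mulr0//; lra.
Qed.

(** The arc between the ends of the antennas has height [k] at its midpoint and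
    [3 k / 4] above [b = - 1 / 2]; the path from the left end to that midpoint
    is a segment inside the lens and has height [k / 2] above [b = - 1 / 2]. *)
Lemma sigma_not_consistent : ~ consistent sigma.
Proof.
pose x : lens_space := Sub _ lens_left; pose y : lens_space := Sub _ lens_right.
have cl : clamp (-2 : R) = -1 by case: (clampP (-2 : R)) => -[] ? ->; lra.
have cr : clamp (2 : R) = 1 by case: (clampP (2 : R)) => -[] ? ->; lra.
have cid (b : R) : -1 <= b <= 1 -> clamp b = b.
  by move=> h; apply: clamp_id; rewrite ler_norml.
have c0 : clamp (0 : R) = 0 by apply: cid; lra.
have k0 := @thin_gt0 R.
have neq : (-1 == 1 :> R) = false by apply/eqP; lra.
have neq0 : (-1 == 0 :> R) = false by apply/eqP; lra.
have long (t : R) : 0 <= t <= 1 -> -1 <= -2 + t * 4 <= 1 ->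
    val (sigma x y t) = (-2 + t * 4, k * (1 - (-2 + t * 4) ^+ 2)).
  move=> t01 h; rewrite val_sigma//=.
  have bE : absc (-2, 0) (2, 0) t = -2 + t * 4 by rewrite /absc /=; ring.
  rewrite /trace bE; congr pair; rewrite /height bE cid// /bulge /=.
  rewrite subrr mulr0 !add0r; congr (_ * _).
  by case: (posP (-1 - -2 : R)) => -[? ->]; case: (posP (2 - 1 : R)) => -[? ->]; lra.
have mid : val (sigma x y (1 / 2)) = (0, k).
  by rewrite long; [congr pair; lra|lra|lra].
have short : val (sigma x (sigma x y (1 / 2)) (3 / 4)) = (- (1 / 2), k / 2).
  rewrite val_sigma; last lra.
  rewrite mid /= /trace.
  have bE : absc (-2, 0) (0, k) (3 / 4) = - (1 / 2) by rewrite /absc /=; lra.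
  rewrite bE; congr pair; rewrite /height /share bE /= cl c0 neq0 cid; last lra.
  have -> : 0 - -1 = 1 :> R by ring.
  by rewrite /bulge /=; case: (posP (0 - 1 : R)) => -[h ->]; move: h; clear; lra.
move/(_ x y 0 (1 / 2)) => /(_ ltac:(lra) ltac:(lra) ltac:(lra)).
have [-> _ _] := sigma_bicombing x y.
move/(_ (sigma x (sigma x y (1 / 2)) (3 / 4))) => [].
  by exists (3 / 4) => //=; rewrite in_itv/=; lra.
move=> t /=; rewrite in_itv/= => t01 E.
have := congr1 val E; rewrite short => E'.
have e1 : absc (-2, 0) (2, 0) t = - (1 / 2).
  by have := congr1 fst E'; rewrite val_sigma.
have tE : t = 3 / 8 by move: e1; rewrite /absc /=; lra.
move: E'; rewrite long//; last by rewrite tE; lra.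
by case=> _; rewrite tE; nra.
Qed.

(** A parametrisation by the square [[-1, 1] ^ 2], extended to the plane by
    clamping so that it is continuous everywhere. *)
Definition square_to_lens (z : R * R) : R * R :=
  (2 * clamp z.1, (1 + clamp z.2) / 2 * width (2 * clamp z.1)).

Lemma width_ge0 (b : R) : 0 <= width b.
Proof.
have [? ?] := clamp_bound b; rewrite /width mulr_ge0 ?(ltW thin_gt0)//.
have : 0 <= (1 - clamp b) * (1 + clamp b) by rewrite mulr_ge0//; lra.
by lra.
Qed.

Lemma lens_square (z : R * R) : lens (square_to_lens z).
Proof.
have [? ?] := clamp_bound z.1; have [? ?] := clamp_bound z.2.
rewrite /lens /square_to_lens /=; apply/andP; split; first by lra.
have w0 := width_ge0 (2 * clamp z.1).
rewrite mulr_ge0//=; last by lra.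
by rewrite ler_piMl//; lra.
Qed.

Definition square_chart (z : R * R) : lens_space := Sub _ (lens_square z).

Lemma square_chart_continuous : continuous square_chart.
Proof.
have c1 : continuous (fun z : R * R => 2 * clamp z.1).
  move=> z; apply: cvgM; first exact: cvg_cst.
  by apply: continuous_comp; [exact: cvg_fst|exact: clamp_continuous].
have c2 : continuous (fun z : R * R => (1 + clamp z.2) / 2 * width (2 * clamp z.1)).
  move=> z; apply: cvgM.
    apply: cvgM; last exact: cvg_cst.
    apply: cvgD; first exact: cvg_cst.
    by apply: continuous_comp; [exact: cvg_snd|exact: clamp_continuous].
  apply: cvgM; first exact: cvg_cst.
  apply: cvgB; first exact: cvg_cst.
  have cc : continuous (fun z : R * R => clamp (2 * clamp z.1)).
    move=> u; apply: (@continuous_comp _ _ _ (fun z : R * R => 2 * clamp z.1) clamp).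
      exact: c1.
    exact: clamp_continuous.
  by rewrite /GRing.exp /=; apply: cvgM; exact: cc.
move=> z; apply/cvg_ballP => e e0.
have e2 : 0 < e / 2 by rewrite divr_gt0.
near=> u.
rewrite ballEmdist /= mdistE /=.
apply: le_lt_trans (nrm_le _ _) _.
rewrite [ltRHS]splitr; apply: ltrD; rewrite distrC; near: u.
  exact: (cvgr_dist_lt _ _ (c1 z) _ e2).
exact: (cvgr_dist_lt _ _ (c2 z) _ e2).
Unshelve. all: by end_near. Qed.

Lemma lens_compact : compact [set: lens_space].
Proof.
have cK : compact (`[-1, 1]%classic `*` `[-1, 1]%classic : set (R * R)).
  by apply: compact_setX; exact: segment_compact.
suff <- : square_chart @` (`[-1, 1] `*` `[-1, 1]) = [set: lens_space].
  apply: continuous_compact => //; apply: continuous_subspaceT.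
  exact: square_chart_continuous.
apply/seteqP; split=> // x _.
have /lensP[b1 b2 u0 u1] := valP x.
rewrite -/(width (val x).1) in u1.
set b := (val x).1 in b1 b2 u1; set u := (val x).2 in u0 u1.
pose v := 2 * (u / width b) - 1.
have w0 := width_ge0 b.
have uw : u / width b * width b = u.
  have [wz|wz] := eqVneq (width b) 0; last by rewrite divfK.
  by rewrite wz mulr0; apply/le_anti; rewrite u0 -wz u1.
have r01 : 0 <= u / width b <= 1.
  rewrite divr_ge0//=; have [->|wz] := eqVneq (width b) 0.
    by rewrite invr0 mulr0 ler01.
  by rewrite ler_pdivrMr ?mul1r// lt_neqAle eq_sym wz.
have cb : 2 * clamp (b / 2) = b.
  by rewrite clamp_id ?ler_norml; lra.
have cv : clamp v = v by rewrite clamp_id// ler_norml /v; lra.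
(* Above an antenna [width b = 0], so [v = - 1], which is as good as any value. *)
exists (b / 2, v).
  by split; rewrite /= in_itv/= /v; lra.
apply: val_inj; rewrite /= /square_to_lens /= cb cv [RHS]surjective_pairing -/b -/u.
by congr pair; rewrite -[RHS]uw /v; congr (_ * _); lra.
Qed.

End Space.

Theorem theorem1p1 (R : realType) :
  exists (X : metricType R) (sigma : X -> X -> R -> X),
    [/\ compact [set: X], convex_bicombing sigma & ~ consistent sigma].
Proof.
exists (lens_space R), (@sigma R); split.
- exact: lens_compact.
- exact: sigma_convex.
- exact: sigma_not_consistent.
Qed.
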